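(* Let $n\ge 1$ be an integer and write $[n]=\{0,\dots,n-1\}$. For each $i\in[n]$ let $B_i$ be a disconnected graph with maximal vertex degree exactly $1$, and let $S_i$ be the subgraph of $B_i$ induced on the vertices that have a neighbor. Let $B_*$ be the co-normal product of the graphs $B_i$, $i \in [n]$. Let $g\colon B_*\to B_*$ be an injective graph homomorphism. Then there exist a permutation $\sigma\colon[n]\to[n]$ and a family of local isomorphisms $g_i\colon S_i\to S_{\sigma(i)}$, $i\in[n]$, such that for all vertices $x=(x_0,\dots,x_{n-1})$ of $B_*$ and all $i\in[n]$, $$x_i\in S_i \;\Rightarrow\; \pi_{\sigma(i)}\,g(x)=g_i(\pi_i x).$$
   Context: Graphs are simple and undirected (no loops), possibly infinite. That $B_i$ is disconnected with maximal degree exactly $1$ means that $B_i$ has at least one edge, has at least two connected components, and every connected component is either a single vertex or two vertices joined by an edge. The co-normal product $B_*$ has vertex set $\prod_{i\in[n]}B_i$, with $u\sim v$ iff there is some $i\in[n]$ with $u_i\sim v_i$ in $B_i$. $\pi_i$ denotes projection to the $i$-th component. A graph homomorphism is a map of vertices sending adjacent vertices to adjacent vertices; injective means injective on vertices. A local isomorphism $h\colon G\to H$ is a graph homomorphism which for each vertex $v$ of $G$ restricts to a bijection from the neighbors of $v$ to the neighbors of $h(v)$; for the graphs $S_i$ (disjoint unions of single edges) this says that each edge-component is mapped isomorphically onto an edge-component. *)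

(* Defs.v *)
From Stdlib Require Export Relation_Operators.
From mathcomp Require Export all_boot all_fingroup.
From mathcomp Require Export boolp classical_sets functions cardinality.

Set Implicit Arguments.
Unset Strict Implicit.
Unset Printing Implicit Defensive.

Local Open Scope classical_set_scope.
Local Open Scope card_scope.

Record sgraph := SGraph {
  vertex :> Type;
  adj : vertex -> vertex -> Prop;
  adj_sym : forall u v, adj u v -> adj v u;
  adj_irr : forall u, ~ adj u u
}.

Definition nbr (G : sgraph) (v : G) : set G := [set w | adj v w].

Definition max_degree_eq (G : sgraph) (d : nat) : Prop :=
  (forall v : G, nbr v #<= `I_d) /\ (exists v : G, nbr v #= `I_d).

Definition linked (G : sgraph) : G -> G -> Prop := clos_refl_trans G (@adj G).

Definition disconnected (G : sgraph) : Prop := exists u v : G, ~ linked u v.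

Definition graph_hom (G H : sgraph) (f : G -> H) : Prop :=
  forall u v : G, adj u v -> adj (f u) (f v).

Definition local_iso (G H : sgraph) (h : G -> H) : Prop :=
  graph_hom h /\ forall v : G, set_bij (nbr v) (nbr (h v)) h.

Section Induced.
Variables (G : sgraph) (A : set G).

Definition induced_adj (u v : A) : Prop := adj (val u) (val v).

Lemma induced_sym u v : induced_adj u v -> induced_adj v u.
Proof. exact: adj_sym. Qed.

Lemma induced_irr u : ~ induced_adj u u.
Proof. exact: adj_irr. Qed.

Definition induced : sgraph := SGraph induced_sym induced_irr.

End Induced.

Definition nonisolated (G : sgraph) : set G := [set v | exists w : G, adj v w].
Arguments nonisolated : clear implicits.

Definition support_graph (G : sgraph) : sgraph := induced (nonisolated G).

Section Conormal.
Variables (I : Type) (B : I -> sgraph).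

Definition conormal_adj (u v : forall i, B i) : Prop :=
  exists i, adj (u i) (v i).

Lemma conormal_sym u v : conormal_adj u v -> conormal_adj v u.
Proof. by case=> i /adj_sym; exists i. Qed.

Lemma conormal_irr u : ~ conormal_adj u u.
Proof. by case=> i /adj_irr. Qed.

Definition conormal : sgraph := SGraph conormal_sym conormal_irr.

End Conormal.

(* Main.v *)
Require Import Defs.

Set Implicit Arguments.
Unset Strict Implicit.
Unset Printing Implicit Defensive.

(**
Each [B i] is a disjoint union of edges and isolated points, hence bipartite,
and choosing a proper 2-colouring of every factor colours the co-normal product
properly with the [2 ^ n] elements of [{ffun I -> bool}].  A point [u] of the
product of the supports spans a cube: the [2 ^ n] points obtained by exchanging
some of the [u i] with their neighbours.  A cube is a clique, and so is its image
under a homomorphism [g]; hence the image of a cube meets every colour exactly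
once, whatever the colouring ([cube_meets_colours]).

This pins down the image of a line.  Let [u'] be [u] with its [i]-th coordinate
exchanged with its neighbour, and let [v] differ from [u] only in coordinate [i].
Then [v] is adjacent to every point of the cube of [u] other than [u] and [u'],
so for every colouring [g v] has the colour of [g u] or that of [g u'].  Two
distinct points of a factor are separated by some 2-colouring, and the factors are
coloured independently; so if [g v] is neither [g u] nor [g u'], then [g u],
[g u'] and [g v] coincide outside one coordinate [j] ([trapped_line]).
Injectivity of [g] and a third vertex in [B i], which exists because [B i] is
disconnected, provide such a [v].  So [g] maps the line through [u] in direction
[i] into the line through [g u] in direction [j] ([line_image]).

For fixed [u], distinct directions [i] have distinct images [j]
([maps_line_inj]), and a look at the squares spanned by two directions shows that
[j] does not depend on [u] ([maps_line_transport], [maps_line_full]).  This is the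
permutation [s], and coordinate [s i] of [g u] depends only on [u i]
([maps_line_coord]), which defines the maps of the statement on the supports.

For a point [x] with [x i] in the support and other coordinates possibly
isolated, compare [g x] with [g t], where [t] runs over the points of a cube whose
[i]-th coordinate is the neighbour of [x i].  All these [t] are adjacent to [x],
and their other coordinates can be chosen so that [g t] is not adjacent to [g x]
in any coordinate other than [s i].  Then [g x] and [g t] are adjacent in
coordinate [s i], which determines [g x (s i)] ([coord_any]).
*)

(** * Graphs of maximal degree one *)

Definition matching_graph (G : sgraph) : Prop :=
  forall x y z : G, adj x y -> adj x z -> y = z.

Lemma matching_graph_degree (G : sgraph) :
  max_degree_eq G 1 -> matching_graph G.
Proof.
case=> leG _ x y z xy xz.
have /pcard_leP [f] := leG x.
have fx w : adj x w -> f w = 0.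
  by move=> xw; have : (f w < 1)%N := @funS _ _ _ _ f w xw; case: (f w).
apply: (@inj _ _ _ f); [exact: mem_set | exact: mem_set |].
exact: etrans (fx _ xy) (esym (fx _ xz)).
Qed.

Lemma nonisolated_degree (G : sgraph) :
  max_degree_eq G 1 -> exists x, nonisolated G x.
Proof.
case=> _ [x degx]; exists x; apply: contrapT => isox.
suff x0 : nbr x = classical_sets.set0.
  move: degx; rewrite x0 card_eq_sym card_eq0 => /eqP I1_0.
  by have : (`I_1)%classic 0 by []; rewrite I1_0.
by rewrite predeqE => w; split=> // xw; apply: isox; exists w.
Qed.

(** A graph with no vertex outside the edge [x y] would be connected. *)
Lemma third_vertex (G : sgraph) (x y : G) :
  disconnected G -> adj x y -> exists w, w <> x /\ w <> y.
Proof.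
case=> a [b nab] xy; apply: contrapT => no_w; apply: nab.
have xORy w : w = x \/ w = y.
  apply: contrapT => nw; apply: no_w; exists w.
  by split=> e; apply: nw; [left | right].
case: (xORy a) (xORy b) => -> [] ->; try exact: rt_refl; apply: rt_step => //.
exact: adj_sym.
Qed.

Lemma nonisolated_nbr (G : sgraph) (x y : G) : adj x y -> nonisolated G y.
Proof. by move/adj_sym=> yx; exists x. Qed.

Definition mate (G : sgraph) (x : G) : G :=
  if pselect (exists w, adj x w) is left e then sval (cid e) else x.

Lemma adj_mate (G : sgraph) (x : G) : nonisolated G x -> adj x (mate x).
Proof. by rewrite /mate; case: pselect => // e _; case: (cid e). Qed.

(** Neighbourhoods are singletons on both sides, so any map between them is a
bijection. *)
Lemma local_iso_matching (G H : sgraph) (h : G -> H) :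
  matching_graph G -> matching_graph H -> (forall x : G, nonisolated G x) ->
  graph_hom h -> local_iso h.
Proof.
move=> mG mH fullG hh; split=> // v; split.
- by move=> w /hh.
- by move=> w w' /set_mem vw /set_mem vw' _; apply: mG vw vw'.
- move=> y hvy; have [w vw] := fullG v; exists w => //.
  exact: mH (hh _ _ vw) hvy.
Qed.

(** * Two-colourings *)

Definition proper (G : sgraph) (c : G -> bool) : Prop :=
  forall x y, adj x y -> c x != c y.

(** There may be infinitely many edges, so choosing an end of each of them
takes the axiom of choice: [e] picks a vertex in every nonempty set, in particular
in every component, and a vertex is coloured according to whether it is the one
picked in its component. *)
Lemma proper_exists (G : sgraph) : matching_graph G -> exists c : G -> bool, proper c.
Proof.
move=> mG; case: (pselect (inhabited G)) => [[x0]|noG]; last first.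
  by exists (fun=> true) => x; case: noG.
have /choice[e eP] (A : G -> Prop) : exists x, (exists y, A y) -> A x.
  case: (pselect (exists y, A y)) => [[y Ay]|noA]; first by exists y.
  by exists x0.
pose comp (x y : G) := y = x \/ adj x y.
have comp_adj x y : adj x y -> comp x = comp y.
  move=> xy; have yx := adj_sym xy; apply/predeqP => z; split=> -[->|az];
    by [left | right | left; apply: mG az _ | right].
exists (fun x => `[< e (comp x) = x >]) => x y xy.
have : comp x (e (comp x)) by apply: eP; exists x; left.
have nxy : x <> y by move=> exy; apply: (adj_irr (u := x)); rewrite {2}exy.
rewrite -(comp_adj _ _ xy) => -[->|xe].
  by rewrite asboolT // asboolF.
by rewrite (mG _ _ _ xe xy) asboolF ?asboolT //; apply: nesym.
Qed.

(** If a proper colouring does not separate [p] and [q], they are not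
adjacent, hence lie in different components; exchanging the two colours on the
component of [q] then separates them. *)
Lemma proper_separates (G : sgraph) (p q : G) :
  matching_graph G -> p <> q -> exists2 c : G -> bool, proper c & c p != c q.
Proof.
move=> mG pq; have [c cP] := proper_exists mG.
have [cpq|] := eqVneq (c p) (c q); last by exists c.
pose comp (x : G) := `[< x = q \/ adj q x >].
exists (fun x => c x (+) comp x).
  move=> x y xy; suff -> : comp x = comp y by rewrite (inj_eq (@addIb _)) cP.
  have yx := adj_sym xy; apply/asbool_equiv_eq.
  split=> -[e|qe]; [right; by rewrite -e | left | right; by rewrite -e | left].
    by apply: mG xy _; apply: adj_sym.
  by apply: mG yx _; apply: adj_sym.
have -> : comp q = true by apply/asboolP; left.
suff -> : comp p = false by rewrite cpq; case: (c q).
apply/asboolP => -[//|/cP]; by rewrite cpq eqxx.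
Qed.

Lemma dfwith_all (I : eqType) (T : I -> Type) (P : forall i, T i -> Prop)
    (f : forall i, T i) (i : I) (t : T i) :
  (forall k, P k (f k)) -> P i t -> forall k, P k (dfwith f t k).
Proof. by move=> Pf Pt k; case: (dfwithP f t k). Qed.

(** * Colourings of co-normal products *)

Section Product.
Variables (I : finType) (B : I -> sgraph).
Hypothesis B_matching : forall i, matching_graph (B i).

Implicit Types (x y z u v : conormal B) (J : {ffun I -> bool}).

Definition prod_colour (c : forall i, B i -> bool) x : {ffun I -> bool} :=
  [ffun i => c i (x i)].

Lemma prod_colour_adj (c : forall i, B i -> bool) x y :
  (forall i, proper (c i)) -> adj x y -> prod_colour c x != prod_colour c y.
Proof.
by move=> cP [i /cP cxy]; apply: contra_neq cxy => /ffunP/(_ i); rewrite !ffunE.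
Qed.

Lemma prod_neq x y : x <> y -> exists i, x i <> y i.
Proof.
move=> xy; apply: contrapT => eq_xy; apply: xy; apply: functional_extensionality_dep.
by move=> i; apply: contrapT => xyi; apply: eq_xy; exists i.
Qed.

(** If [j] and [k] were distinct, a colouring separating [a] from [c] in factor
[j] and [b] from [c] in factor [k] would give [c] a colour different from those of
both [a] and [b]. *)
Lemma same_direction a b c j k :
  (forall col : forall i, B i -> bool, (forall i, proper (col i)) ->
     prod_colour col c = prod_colour col a \/
     prod_colour col c = prod_colour col b) ->
  a j <> c j -> b k <> c k -> j = k.
Proof.
move=> trapped acj bck; apply: contrapT => /eqP jk.
have [cj cjP sepj] := proper_separates (@B_matching j) acj.
have [ck ckP sepk] := proper_separates (@B_matching k) bck.
pose col0 i := sval (cid (proper_exists (@B_matching i))).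
have col0P i : proper (col0 i) by rewrite /col0; case: cid.
pose col : forall i, B i -> bool :=
  dfwith (dfwith col0 cj : forall i, B i -> bool) ck.
have colj : col j = cj by rewrite /col dfwith_out ?dfwith_in // eq_sym.
have colk : col k = ck by rewrite /col dfwith_in.
have colP i : proper (col i).
  by do 2 apply: (dfwith_all (P := fun i => @proper (B i))) => //.
case: (trapped col colP) => /ffunP.
  by move/(_ j)/esym/eqP; rewrite !ffunE colj (negbTE sepj).
by move/(_ k)/esym/eqP; rewrite !ffunE colk (negbTE sepk).
Qed.

(** By [same_direction], every coordinate where [a] differs from [c] equals
every coordinate where [b] does; as there are some of each kind, all are one and
the same [j]. *)
Lemma trapped_line a b c :
  (forall col : forall i, B i -> bool, (forall i, proper (col i)) ->
     prod_colour col c = prod_colour col a \/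
     prod_colour col c = prod_colour col b) ->
  c <> a -> c <> b ->
  exists j, forall k, k != j -> a k = c k /\ b k = c k.
Proof.
move=> trapped /nesym/prod_neq[j acj] /nesym/prod_neq[l bcl].
have dir := same_direction trapped.
have {l bcl} bcj : b j <> c j by rewrite (dir _ _ acj bcl).
exists j => k /eqP kj; split; apply: contrapT => ne; apply: kj.
  exact: dir ne bcj.
exact: esym (dir _ _ acj ne).
Qed.

(** * Cubes *)

(** The points of the product of the supports. *)
Definition full x : Prop := forall i, nonisolated (B i) (x i).

Definition flip J x : conormal B := fun i => if J i then mate (x i) else x i.

Definition flip1 i x : conormal B := dfwith (x : forall i, B i) (mate (x i)).

Lemma full_flip J x : full x -> full (flip J x).
Proof.
by move=> fx i; rewrite /flip; case: (J i) => //; apply/nonisolated_nbr/adj_mate.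
Qed.

Lemma full_dfwith u i p : full u -> nonisolated (B i) p ->
  full (dfwith (u : forall i, B i) p).
Proof. by move=> fu Sp; apply: (dfwith_all (P := fun i => nonisolated (B i))). Qed.

Lemma full_flip1 i x : full x -> full (flip1 i x).
Proof.
by move=> fx; apply: full_dfwith => //; apply/nonisolated_nbr/adj_mate.
Qed.

Lemma adj_flip1 i x : full x -> adj (x i) (flip1 i x i).
Proof. by move=> fx; rewrite /flip1 dfwith_in; apply: adj_mate. Qed.

Lemma adj_flip J J' u : full u -> J != J' -> adj (flip J u) (flip J' u).
Proof.
move=> fu JJ'; have [i JJi] : exists i, J i != J' i.
  apply/existsP; rewrite -negb_forall; apply: contra JJ' => /forallP eqJ.
  by apply/eqP/ffunP => i; apply/eqP.
have := adj_mate (fu i).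
by exists i; rewrite /flip; move: JJi; case: (J i); case: (J' i) => // _; apply: adj_sym.
Qed.

Variables (g : conormal B -> conormal B).
Hypotheses (g_hom : graph_hom g) (g_inj : injective g).

(** Colouring the image of a cube is an injection, since the cube is a clique;
there are as many points in the cube as colours, so it is onto. *)
Lemma cube_meets_colours (c : forall i, B i -> bool) u (d : {ffun I -> bool}) :
  (forall i, proper (c i)) -> full u ->
  exists J, prod_colour c (g (flip J u)) = d.
Proof.
move=> cP fu; pose f J := prod_colour c (g (flip J u)).
have f_inj : injective f.
  move=> J J' eqf; apply/eqP; apply: contra_eqT eqf => JJ'.
  exact/prod_colour_adj/g_hom/adj_flip.
by have /codomP[J ->] := injF_onto f_inj d; exists J.
Qed.

(** Some point [flip J u] of the cube has an image of the same colour as [g v],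
hence is not adjacent to [v]; since [v] agrees with [u] outside [i], this
excludes [J k] for [k != i]. *)
Lemma image_trapped u v i (c : forall i, B i -> bool) :
  full u -> (forall k, k != i -> v k = u k) -> (forall i, proper (c i)) ->
  prod_colour c (g v) = prod_colour c (g u) \/
  prod_colour c (g v) = prod_colour c (g (flip1 i u)).
Proof.
move=> fu vu cP; have [J cJ] := cube_meets_colours (prod_colour c (g v)) cP fu.
have nadj : ~ adj v (flip J u).
  by move=> /g_hom/(prod_colour_adj cP); rewrite cJ eqxx.
have offJ k : k != i -> J k = false.
  move=> ki; apply/negP => Jk; apply: nadj; exists k.
  by rewrite vu // /flip Jk; apply: adj_mate.
rewrite -cJ; case Ji: (J i); [right | left]; do 2 f_equal;
  apply: functional_extensionality_dep => k; rewrite /flip.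
  rewrite /flip1; case: (@dfwithP _ _ _ i _ k) => [|j]; first by rewrite Ji.
  by rewrite eq_sym => /offJ->.
by have [->|/offJ->//] := eqVneq k i; rewrite Ji.
Qed.

(** * Lines *)

Hypothesis B_third : forall i (p q : B i), adj p q -> exists r : B i, r <> p /\ r <> q.

(** The line through [u] in direction [i] is sent into the line through [g u]
in direction [j]. *)
Definition maps_line u i j : Prop :=
  forall v, (forall k, k != i -> v k = u k) -> forall k, k != j -> g v k = g u k.

Lemma flip1_out i k u : k != i -> flip1 i u k = u k.
Proof. by move=> ki; rewrite /flip1 dfwith_out // eq_sym. Qed.

(** The images of two neighbours on the line are adjacent, and they can only be
so in the coordinate where they differ. *)
Lemma maps_line_adj u i j : full u -> maps_line u i j ->
  adj (g u j) (g (flip1 i u) j).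
Proof.
move=> fu line.
have [l adjl] : adj (g u) (g (flip1 i u)) by apply: g_hom; exists i; apply: adj_flip1.
have [<-//|lj] := eqVneq l j.
by case: (adj_irr (u := g u l)); rewrite -{2}(line (flip1 i u)) // => k; apply: flip1_out.
Qed.

(** The direction [l] is a coordinate in which the images of [u] and its
neighbour on the line are adjacent.  A point of the line other than these two is
trapped between them, which forces all three images to agree outside [l]. *)
Lemma line_image u i : full u -> exists j, maps_line u i j.
Proof.
move=> fu; have uu' := adj_flip1 i fu.
have [l adjl] : adj (g u) (g (flip1 i u)) by apply: g_hom; exists i.
(* [l] has to be the exceptional coordinate of [trapped_line], because [g u] and
   [g (flip1 i u)] are adjacent there. *)
have close v : (forall k, k != i -> v k = u k) -> v <> u -> v <> flip1 i u ->
    forall k, k != l -> g u k = g v k /\ g (flip1 i u) k = g v k.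
  move=> vu nvu nvu'.
  have [| |j jP] := trapped_line (fun col => image_trapped fu vu (c := col));
    try by move/g_inj.
  suff -> : l = j by [].
  apply/eqP/negP => /negP/jP[el el'].
  by apply: (adj_irr (u := g u l)); rewrite {2}el -el'.
have [w [wu wu']] := B_third uu'.
pose v := dfwith (u : forall i, B i) w.
have vi : v i = w by rewrite /v dfwith_in.
have vu k : k != i -> v k = u k by move=> ki; rewrite /v dfwith_out // eq_sym.
have nvu : v <> u by move=> evu; apply: wu; rewrite -vi evu.
have nvu' : v <> flip1 i u by move=> evu; apply: wu'; rewrite -vi evu.
(* Without a third point on the line, nothing would force the images of the two
   neighbours to agree outside [l]. *)
have twins k : k != l -> g (flip1 i u) k = g u k.
  by case/(close v vu nvu nvu') => -> ->.
exists l => v' v'u k kl.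
have [->//|nv'u] := pselect (v' = u).
have [->|nv'u'] := pselect (v' = flip1 i u); first exact: twins.
by have [] := close v' v'u nv'u nv'u' k kl.
Qed.

(** If two directions had the same image, the neighbours of [u] in these two
directions would have the same image: the neighbour of [g u] in direction [j]. *)
Lemma maps_line_inj u i k j : full u ->
  maps_line u i j -> maps_line u k j -> i = k.
Proof.
move=> fu li lk; apply/eqP/negP => /negP ik.
have eqf : flip1 i u = flip1 k u.
  apply/g_inj/functional_extensionality_dep => m.
  have [->|mj] := eqVneq m j.
    exact: B_matching (maps_line_adj fu li) (maps_line_adj fu lk).
  by rewrite li ?lk // => m'; apply: flip1_out.
have := adj_flip1 i fu; rewrite eqf flip1_out //; exact: adj_irr.
Qed.

(** * Directions do not depend on the base point *)

(** For [k != i], consider the square formed by [u], [v] and their neighbours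
[u'] and [x] in direction [k].  The sides [u u'] and [u v] go to directions
[j != l], the side [v x] to [j'], and [u' x] to [l'].  If [j'] were not [j],
going from [g u] to [g x] through [g v] would leave coordinate [j] unchanged,
while [g u'] differs from [g u] there; so [l'] would be [j], and the path
through [g u'] would change nothing but coordinate [j].  Then [g x = g u],
contradicting injectivity. *)
Lemma maps_line_transport u v i k j :
  full u -> full v -> (forall m, m != i -> v m = u m) ->
  maps_line u k j -> maps_line v k j.
Proof.
move=> fu fv vu lu; have [l li] := line_image i fu.
have [ik|ik] := eqVneq i k.
  rewrite -{}ik in lu li *; move=> w wv m mj.
  by rewrite !lu // => m' m'i; rewrite wv // vu.
have lj : l != j.
  by apply: contra ik => /eqP ljE; rewrite ljE in li; rewrite (maps_line_inj fu li lu).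
have [j' lv] := line_image k fv.
suff -> : j = j' by [].
apply/eqP/negP => /negP jj'.
pose x := flip1 k v; pose u' := flip1 k u.
have fu' : full u' by apply: full_flip1.
have u'u m : m != k -> u' m = u m by apply: flip1_out.
have xv m : m != k -> x m = v m by apply: flip1_out.
have xu' m : m != i -> x m = u' m.
  move=> mi; have [->|mk] := eqVneq m k; last by rewrite xv ?u'u // vu.
  by rewrite /x /u' /flip1 !dfwith_in vu // eq_sym.
have [l' lu'] := line_image i fu'.
have gxj : g x j = g u j by rewrite lv // li // eq_sym.
have l'j : l' = j.
  apply/eqP/negP => /negP l'j; apply: (adj_irr (u := g u j)).
  by rewrite -{2}gxj (lu' x) 1?eq_sym //; apply: maps_line_adj.
have gxu : g x = g u.
  apply: functional_extensionality_dep => m.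
  have [->//|mj] := eqVneq m j.
  by rewrite (lu' x) ?l'j // (lu u').
have := adj_flip1 k fv; rewrite -/x (g_inj gxu) vu 1?eq_sym //; exact: adj_irr.
Qed.

(** Going from [u] to [v] by changing one coordinate at a time. *)
Lemma change_coordinates (P : conormal B -> Prop) u v :
  P u -> (forall i z, P z -> P (dfwith (z : forall i, B i) (v i))) -> P v.
Proof.
move=> Pu step.
pose mix s : conormal B := foldr (fun i z => dfwith (z : forall i, B i) (v i)) u s.
have mixE s i : i \in s -> mix s i = v i.
  elim: s => //= k s IH; rewrite inE.
  have [->|ik] := eqVneq i k; first by rewrite dfwith_in.
  by rewrite dfwith_out // eq_sym.
have <- : mix (enum I) = v.
  by apply: functional_extensionality_dep => i; rewrite mixE ?mem_enum.
by elim: (enum I) => //= i s; apply: step.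
Qed.

Lemma maps_line_full u v k j : full u -> full v -> maps_line u k j -> maps_line v k j.
Proof.
move=> fu fv lu; pose P z := full z /\ maps_line z k j.
suff [] : P v by [].
apply: (@change_coordinates P u) => // i z [fz lz].
have fz' := full_dfwith fz (fv i); split=> //.
apply: (maps_line_transport (i := i) fz fz' _ lz) => m mi.
by rewrite dfwith_out // eq_sym.
Qed.

(** Changing a coordinate [i != k] changes the image only in the direction of
[i], which is not [j] by [maps_line_inj]. *)
Lemma maps_line_coord u v k j : full u -> full v -> maps_line u k j ->
  u k = v k -> g v j = g u j.
Proof.
move=> fu fv lu uv; pose P z := [/\ full z, z k = v k & g z j = g u j].
suff [] : P v by [].
apply: (@change_coordinates P u) => // i z [fz zk gz].
have fz' := full_dfwith fz (fv i).
have zz' m : m != i -> dfwith (z : forall i, B i) (v i) m = z m.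
  by move=> mi; rewrite dfwith_out // eq_sym.
have [ik|ik] := eqVneq i k.
  suff -> : dfwith (z : forall i, B i) (v i) = z by [].
  apply: functional_extensionality_dep => m.
  have [->|/zz'//] := eqVneq m i; rewrite dfwith_in.
  by move: (v) zk; rewrite ik => ? ->.
split=> //; first by rewrite zz' // eq_sym.
rewrite -gz; have [l li] := line_image i fz.
rewrite li // => //; apply: contra ik => /eqP jl.
by rewrite -jl in li; rewrite (maps_line_inj fz li (maps_line_full fu fz lu)).
Qed.

Lemma line_permutation u0 : full u0 ->
  exists s : {perm I}, forall u, full u -> forall i, maps_line u i (s i).
Proof.
move=> fu0; have /choice[s sP] i := line_image i fu0.
have s_inj : injective s.
  by move=> i k sik; apply: (maps_line_inj fu0 (sP i)); rewrite sik.
by exists (perm s_inj) => u fu i; rewrite permE; apply: maps_line_full (sP i).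
Qed.

(** * Coordinates of the image of an arbitrary vertex *)

Lemma adj_direction u v i j : full u -> maps_line u i j ->
  (forall k, k != i -> v k = u k) -> adj (u i) (v i) -> adj (g u j) (g v j).
Proof.
move=> fu lu vu uv; suff -> : v = flip1 i u by apply: maps_line_adj.
apply: functional_extensionality_dep => k; have [->|ki] := eqVneq k i.
  exact: B_matching uv (adj_flip1 i fu).
by rewrite vu // flip1_out.
Qed.

Lemma flip_coord (s : {perm I}) u J k :
  full u -> (forall i, maps_line u i (s i)) -> J k ->
  adj (g u (s k)) (g (flip J u) (s k)).
Proof.
move=> fu lu Jk; suff -> : g (flip J u) (s k) = g (flip1 k u) (s k).
  exact: maps_line_adj.
apply: maps_line_coord (maps_line_full fu (full_flip1 k fu) (lu k)) _.
- exact: full_flip1.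
- exact: full_flip.
- by rewrite /flip1 dfwith_in /flip Jk.
Qed.

(** In each coordinate [s k] with [k != i], the values [g t (s k)] available
for [t] in the cube of [u] include two adjacent ones, and [g x (s k)] is not
adjacent to both; so some [t] adjacent to [x] in coordinate [i] has an image that
can only be adjacent to [g x] in coordinate [s i]. *)
Lemma coord_any (s : {perm I}) u x i :
  full u -> (forall i, maps_line u i (s i)) -> u i = x i ->
  g x (s i) = g u (s i).
Proof.
move=> fu lu uxi.
(* [flip J u] is this [t]: it takes the other value in coordinate [k] exactly
   when the one given by [u] makes [g x] and [g u] adjacent in coordinate [s k]. *)
pose J := [ffun k => (k == i) || `[< adj (g x (s k)) (g u (s k)) >]].
have Ji : J i by rewrite ffunE eqxx.
have [l] : adj (g x) (g (flip J u)).
  by apply: g_hom; exists i; rewrite /flip Ji -uxi; apply: adj_mate.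
rewrite -(permKV s l); move: (s^-1%g l) => {}k adjk.
have [ki|ki] := eqVneq k i.
  apply: (B_matching (adj_sym _) (adj_sym (flip_coord fu lu Ji))).
  by rewrite -ki.
case Jk: (J k); last first.
  move: (Jk); rewrite ffunE (negbTE ki) => /asboolP[].
  suff <- : g (flip J u) (s k) = g u (s k) by [].
  by apply: maps_line_coord (lu k) _ => //; [apply: full_flip | rewrite /flip Jk].
have := Jk; rewrite ffunE (negbTE ki) => /asboolP adjk'.
have := flip_coord fu lu Jk; rewrite (B_matching adjk adjk').
by move/adj_irr.
Qed.

End Product.

Theorem theorem4p1 (n : nat) (hn : 0 < n) (B : 'I_n -> sgraph)
    (B_disc : forall i, disconnected (B i))
    (B_deg : forall i, max_degree_eq (B i) 1)
    (g : conormal B -> conormal B)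
    (g_hom : graph_hom g) (g_inj : injective g) :
  exists (sigma : {perm 'I_n})
         (h : forall i, support_graph (B i) -> support_graph (B (sigma i))),
    (forall i, local_iso (h i)) /\
    (forall (x : conormal B) (i : 'I_n) (xi : x i \in nonisolated (B i)),
       g x (sigma i) = val (h i (exist _ (x i) xi))).
Proof.
have mB i := matching_graph_degree (B_deg i).
have B_third i (x y : B i) : adj x y -> exists w, w <> x /\ w <> y.
  exact: third_vertex.
have [u0 fu0] : exists u0 : conormal B, full u0.
  by exists (fun i => sval (cid (nonisolated_degree (B_deg i)))) => i; case: cid.
have [s sP] := line_permutation mB g_hom g_inj B_third fu0.
pose base i (p : support_graph (B i)) : conormal B :=
  dfwith (u0 : forall i, B i) (val p).
have fbase i p : full (@base i p) by apply: full_dfwith => //; apply/set_mem/valP.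
have hS i p : g (base i p) (s i) \in nonisolated (B (s i)).
  apply/mem_set/nonisolated_nbr/adj_sym.
  exact: maps_line_adj (sP _ (fbase i p) i).
exists s, (fun i p => exist _ (g (base i p) (s i)) (hS i p)); split=> [i|x i xi] /=.
  have mS (H : sgraph) : matching_graph H -> matching_graph (support_graph H).
    by move=> mH x y z xy xz; apply/val_inj/(mH _ _ _ xy xz).
  apply: local_iso_matching; [exact: mS|exact: mS| |].
    move=> x; have /set_mem[y xy] := valP x.
    by exists (exist _ y (mem_set (nonisolated_nbr xy))).
  move=> p q pq; apply: (adj_direction mB g_hom (i := i)) (sP _ _ i) _ _ => //.
    by move=> k ki; rewrite /base !dfwith_out // eq_sym.
  by rewrite /base !dfwith_in.
apply: (coord_any mB g_hom g_inj B_third) => //; first by move=> k; apply: sP.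
by rewrite /base dfwith_in.
Qed.
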